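(* Assume that $\mathcal K_{js}$ is nonempty, that the sublevel set $\mathcal K_{js,\gamma}$ is compact, and that $J_{SA}$ is continuously differentiable and $L$-smooth on $\mathcal K_{js,\gamma}$ for some $L>0$. Assume further (gradient dominance) that there exist $\mu>0$ and a minimizer $K_\star\in\mathcal K_{js,\gamma}$ of $J_{SA}$ such that $$J_{SA}(K)-J_{SA}(K_\star)\le\frac1{2\mu}\|\nabla J_{SA}(K)\|_F^2\qquad\forall K\in\mathcal K_{js,\gamma}.$$ Let $c_d>0$ be a constant such that $\langle\nabla J_{SA}(K),\Delta(K)\rangle\le -c_d\|\Delta(K)\|_F^2$ for all $K\in\mathcal K_{js,\gamma}$. Let $\bar\alpha>0$ and $\alpha=\min\{\bar\alpha,\,c_d/L\}$, where $\bar\alpha$ is such that for every $K_0\in\mathcal K_{js,\gamma}$ the sequence generated by $K_{i+1}=K_i+\alpha\Delta_i$, $\Delta_i=\Delta(K_i)$, satisfies $K_i+a\Delta_i\in\mathcal K_{js}$ for every $i\ge0$ and every $a\in[0,\bar\alpha]$. Then there exists $q\in(0,1)$ such that for any $K_0\in\mathcal K_{js,\gamma}$ the sequence $\{K_i\}$ generated from $K_0$ satisfies $$J_{SA}(K_i)-J_{SA}(K_\star)\le q^i\big(J_{SA}(K_0)-J_{SA}(K_\star)\big)\qquad\forall i\ge0.$$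
   Context: Let $M\ge 1$, $[M]=\{1,\dots,M\}$, and let $(A_j,B_j)$, $j\in[M]$, be given (sampled) system matrices with $A_j\in\mathbb{R}^{n\times n}$, $B_j\in\mathbb{R}^{n\times m}$. Let $Q\in\mathbb{R}^{n\times n}$ be symmetric with $Q\succeq 0$ and $R\in\mathbb{R}^{m\times m}$ symmetric with $R\succ 0$. $\rho(\cdot)$ denotes the spectral radius, $\langle\cdot,\cdot\rangle$ the Frobenius inner product and $\|\cdot\|_F$ the Frobenius norm. Define $$\mathcal K_{js}=\{K\in\mathbb{R}^{m\times n}:\rho(A_j+B_jK)<1\ \ \forall j\in[M]\}.$$ For $K\in\mathcal K_{js}$ let $P_j(K)$, $\Sigma_j(K)$ be the unique solutions of $$P_j=Q+K^\top RK+(A_j+B_jK)^\top P_j(A_j+B_jK),$$ $$\Sigma_j=I+(A_j+B_jK)\Sigma_j(A_j+B_jK)^\top .$$ The sample-average objective is $J_{SA}(K)=\frac1M\sum_{j=1}^M\mathrm{Tr}\big((Q+K^\top RK)\Sigma_j(K)\big)$ for $K\in\mathcal K_{js}$. For a fixed finite $\gamma$, $\mathcal K_{js,\gamma}=\{K\in\mathcal K_{js}:J_{SA}(K)\le\gamma\}$. ''$L$-smooth on $\mathcal K_{js,\gamma}$'' means that $\nabla J_{SA}$ is $L$-Lipschitz in the Frobenius norm on $\mathcal K_{js,\gamma}$. For $K\in\mathcal K_{js}$, let $\widehat K(K)$ be the unique solution $\widehat K\in\mathbb{R}^{m\times n}$ of $$\sum_{j=1}^M\Big[(R+B_j^\top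 P_j(K)B_j)\widehat K+B_j^\top P_j(K)A_j\Big]\Sigma_j(K)=0,$$ and let $\Delta(K):=\widehat K(K)-K$ be the policy-improvement direction. *)

(* Defs.v *)
From HB Require Import structures.
From mathcomp Require Import all_boot all_order all_algebra.
From mathcomp Require Import all_classical all_reals all_analysis.
From mathcomp Require Import complex.

Set Implicit Arguments.
Unset Strict Implicit.
Unset Printing Implicit Defensive.

Import Order.TTheory GRing.Theory Num.Theory.
Import numFieldNormedType.Exports.

Local Open Scope classical_set_scope.
Local Open Scope ring_scope.

Section Matrices.
Context {F : realType}.

Definition sym_psd n (X : 'M[F]_n) : Prop :=
  X^T = X /\ forall x : 'cV[F]_n, 0 <= (x^T *m X *m x) 0 0.

Definition sym_pd n (X : 'M[F]_n) : Prop :=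
  X^T = X /\ forall x : 'cV[F]_n, x != 0 -> 0 < (x^T *m X *m x) 0 0.

(* The eigenvalues are taken in F[i].  The set of moduli is finite; for n = 0
   it is empty and the spectral radius is sup set0 = 0. *)
Definition spectral_radius n (X : 'M[F]_n) : F :=
  sup [set ComplexField.Normc.normc z | z in
        [set z : F[i] | eigenvalue (map_mx (real_complex F) X) z]].

Definition frob_inner m n (X Y : 'M[F]_(m, n)) : F := \tr (X^T *m Y).

Definition frob_norm m n (X : 'M[F]_(m, n)) : F := Num.sqrt (frob_inner X X).

(* The matrix representing 'd f K for the Frobenius inner product, i.e. the
   matrix of partial derivatives (meaningful when f is differentiable at K). *)
Definition gradient m n (f : 'M[F]_(m, n) -> F) (K : 'M[F]_(m, n)) :
    'M[F]_(m, n) :=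
  \matrix_(i, j) 'd f K (delta_mx i j).

(* Differentiability at the points of S is that of f on the whole space; in
   the application S lies in the open domain of f. *)
Definition continuously_differentiable_on m n (f : 'M[F]_(m, n) -> F)
    (S : set 'M[F]_(m, n)) : Prop :=
  (forall K, S K -> differentiable f K) /\ {within S, continuous (gradient f)}.

Definition smooth_on m n (L : F) (f : 'M[F]_(m, n) -> F)
    (S : set 'M[F]_(m, n)) : Prop :=
  forall K K', S K -> S K' ->
    frob_norm (gradient f K - gradient f K') <= L * frob_norm (K - K').

End Matrices.

Section SampledLQR.
Context {F : realType} {n m M : nat}.

Definition closed_loop (A : 'M[F]_n) (B : 'M[F]_(n, m)) (K : 'M[F]_(m, n)) :
    'M[F]_n :=
  A + B *m K.

(* On the domain of use each of the following equations has exactly one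
   solution, which xget returns; elsewhere the value is irrelevant. *)
Definition lyap_P (Q : 'M[F]_n) (R : 'M[F]_m) (A : 'M[F]_n) (B : 'M[F]_(n, m))
    (K : 'M[F]_(m, n)) : 'M[F]_n :=
  xget 0 [set P | P = Q + K^T *m R *m K
                      + (closed_loop A B K)^T *m P *m closed_loop A B K].

Definition lyap_Sigma (A : 'M[F]_n) (B : 'M[F]_(n, m)) (K : 'M[F]_(m, n)) :
    'M[F]_n :=
  xget 0 [set S | S = 1%:M
                      + closed_loop A B K *m S *m (closed_loop A B K)^T].

Definition K_js (A : 'I_M -> 'M[F]_n) (B : 'I_M -> 'M[F]_(n, m)) :
    set 'M[F]_(m, n) :=
  [set K | forall j, spectral_radius (closed_loop (A j) (B j) K) < 1].

(* Only meaningful on K_js A B. *)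
Definition J_SA (Q : 'M[F]_n) (R : 'M[F]_m)
    (A : 'I_M -> 'M[F]_n) (B : 'I_M -> 'M[F]_(n, m)) (K : 'M[F]_(m, n)) : F :=
  M%:R^-1 *
    \sum_(j < M) \tr ((Q + K^T *m R *m K) *m lyap_Sigma (A j) (B j) K).

Definition K_js_sub (Q : 'M[F]_n) (R : 'M[F]_m)
    (A : 'I_M -> 'M[F]_n) (B : 'I_M -> 'M[F]_(n, m)) (gamma : F) :
    set 'M[F]_(m, n) :=
  [set K | K_js A B K /\ J_SA Q R A B K <= gamma].

Definition K_hat (Q : 'M[F]_n) (R : 'M[F]_m)
    (A : 'I_M -> 'M[F]_n) (B : 'I_M -> 'M[F]_(n, m)) (K : 'M[F]_(m, n)) :
    'M[F]_(m, n) :=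
  xget 0 [set Kh |
    \sum_(j < M)
      (((R + (B j)^T *m lyap_P Q R (A j) (B j) K *m B j) *m Kh
        + (B j)^T *m lyap_P Q R (A j) (B j) K *m A j)
       *m lyap_Sigma (A j) (B j) K) = 0].

Definition Delta (Q : 'M[F]_n) (R : 'M[F]_m)
    (A : 'I_M -> 'M[F]_n) (B : 'I_M -> 'M[F]_(n, m)) (K : 'M[F]_(m, n)) :
    'M[F]_(m, n) :=
  K_hat Q R A B K - K.

Definition policy_iter (Q : 'M[F]_n) (R : 'M[F]_m)
    (A : 'I_M -> 'M[F]_n) (B : 'I_M -> 'M[F]_(n, m)) (alpha : F)
    (K0 : 'M[F]_(m, n)) (i : nat) : 'M[F]_(m, n) :=
  iter i (fun K => K + alpha *: Delta Q R A B K) K0.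

End SampledLQR.

(* Main.v *)
(* By duality of the Lyapunov equations the gradient of J_SA is
   (2 / M) * sum_j [(R + B_j^T P_j B_j) K + B_j^T P_j A_j] Sigma_j, so that the
   equation defining K_hat turns it into
   - (2 / M) * sum_j (R + B_j^T P_j B_j) Delta Sigma_j.  The matrices P_j and
   Sigma_j are continuous in the gain, hence bounded on the compact sublevel set,
   and |gradient|^2 <= C |Delta|^2 there.  On the other hand, smoothness and the
   descent condition keep the segment from K to K + alpha Delta in the sublevel
   set and make J_SA decrease along it by at least (alpha c_d / 2) |Delta|^2.
   Gradient dominance then gives the ratio 1 - alpha c_d mu / C. *)
Require Import Defs.
From HB Require Import structures.
From mathcomp Require Import all_boot all_order all_algebra.
From mathcomp Require Import all_classical all_reals all_analysis.
From mathcomp Require Import complex ring lra.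

Set Implicit Arguments.
Unset Strict Implicit.
Unset Printing Implicit Defensive.

Import Order.TTheory GRing.Theory Num.Theory.
Import numFieldNormedType.Exports.
Local Open Scope classical_set_scope.
Local Open Scope ring_scope.

(** * Limits of matrices *)

Section MatrixLimits.
Context {F : realType} {T : Type} {G : set_system T} {FG : Filter G}.

Lemma cvg_mx_entries m n (X : T -> 'M[F]_(m, n)) (Y : 'M[F]_(m, n)) :
  (forall i j, X t i j @[t --> G] --> Y i j) -> X t @[t --> G] --> Y.
Proof.
move=> h; apply/cvg_ballP => e e0.
have : \forall t \near G, forall i j, ball (Y i j) e (X t i j).
  apply: filter_forall => i; apply: filter_forall => j.
  by move: (h i j) => /cvg_ballP; apply.
by apply: filterS => t ht; split.
Qed.

Lemma cvg_entry m n (X : T -> 'M[F]_(m, n)) (Y : 'M[F]_(m, n)) i j :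
  X t @[t --> G] --> Y -> X t i j @[t --> G] --> Y i j.
Proof.
by move=> h; apply: (continuous_cvg _ (@coord_continuous _ _ _ i j Y)).
Qed.

Lemma cvg_bigsum (I : Type) (r : seq I) (P : pred I) (f : I -> T -> F)
    (a : I -> F) :
  (forall i, P i -> f i t @[t --> G] --> a i) ->
  (\sum_(i <- r | P i) f i t) @[t --> G] --> \sum_(i <- r | P i) a i.
Proof. by apply: cvg_big; exact: add_continuous. Qed.

Lemma cvg_bigprod (I : Type) (r : seq I) (P : pred I) (f : I -> T -> F)
    (a : I -> F) :
  (forall i, P i -> f i t @[t --> G] --> a i) ->
  (\prod_(i <- r | P i) f i t) @[t --> G] --> \prod_(i <- r | P i) a i.
Proof. by apply: cvg_big; exact: mul_continuous. Qed.

Lemma cvg_trmx m n (X : T -> 'M[F]_(m, n)) (Y : 'M[F]_(m, n)) :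
  X t @[t --> G] --> Y -> (X t)^T @[t --> G] --> Y^T.
Proof.
move=> h; apply: cvg_mx_entries => i j; rewrite mxE.
under eq_fun do rewrite mxE.
exact: cvg_entry.
Qed.

Lemma cvg_mulmx m n p (X : T -> 'M[F]_(m, n)) (X' : 'M[F]_(m, n))
    (Y : T -> 'M[F]_(n, p)) (Y' : 'M[F]_(n, p)) :
  X t @[t --> G] --> X' -> Y t @[t --> G] --> Y' ->
  X t *m Y t @[t --> G] --> X' *m Y'.
Proof.
move=> hX hY; apply: cvg_mx_entries => i j; rewrite mxE.
under eq_fun do rewrite mxE.
by apply: cvg_bigsum => k _; apply: cvgM; exact: cvg_entry.
Qed.

Lemma cvg_mxtrace n (X : T -> 'M[F]_n) (Y : 'M[F]_n) :
  X t @[t --> G] --> Y -> \tr (X t) @[t --> G] --> \tr Y.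
Proof. by move=> h; apply: cvg_bigsum => i _; exact: cvg_entry. Qed.

Lemma cvg_det n (X : T -> 'M[F]_n) (Y : 'M[F]_n) :
  X t @[t --> G] --> Y -> \det (X t) @[t --> G] --> \det Y.
Proof.
move=> h; apply: cvg_bigsum => s _; apply: cvgM; first exact: cvg_cst.
by apply: cvg_bigprod => i _; exact: cvg_entry.
Qed.

Lemma cvg_adjugate n (X : T -> 'M[F]_n) (Y : 'M[F]_n) :
  X t @[t --> G] --> Y -> \adj (X t) @[t --> G] --> \adj Y.
Proof.
move=> h; apply: cvg_mx_entries => i j; rewrite mxE.
under eq_fun do rewrite mxE.
apply: cvgM; first exact: cvg_cst.
apply: cvg_det; apply: cvg_mx_entries => k l; rewrite !mxE.
under eq_fun do rewrite !mxE.
exact: cvg_entry.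
Qed.

Lemma near_unitmx n (X : T -> 'M[F]_n) (Y : 'M[F]_n) :
  Y \in unitmx -> X t @[t --> G] --> Y -> \forall t \near G, X t \in unitmx.
Proof.
rewrite unitmxE unitfE => Y0 /cvg_det h.
have h' := @cvgr_neq0 _ _ _ _ FG _ _ h Y0.
by apply: filterS h' => t ht; rewrite unitmxE unitfE.
Qed.

(** [invmx] is defined by cases, but invertibility persists near [Y], and there it is the adjugate
    divided by the determinant, which is continuous. *)
Lemma cvg_invmx n (X : T -> 'M[F]_n) (Y : 'M[F]_n) :
  Y \in unitmx -> X t @[t --> G] --> Y -> invmx (X t) @[t --> G] --> invmx Y.
Proof.
move=> Yu h.
have -> : invmx Y = (\det Y)^-1 *: \adj Y by rewrite /invmx Yu.
have H : (\det (X t))^-1 *: \adj (X t) @[t --> G] --> (\det Y)^-1 *: \adj Y.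
  apply: cvgZ; last exact: cvg_adjugate.
  by apply: cvgV; [move: Yu; rewrite unitmxE unitfE | exact: cvg_det].
apply: (cvg_trans _ H); apply: near_eq_cvg.
by apply: filterS (near_unitmx Yu h) => t ht; rewrite /invmx ht.
Qed.

Lemma cvg_mxvec m n (X : T -> 'M[F]_(m, n)) (Y : 'M[F]_(m, n)) :
  X t @[t --> G] --> Y -> mxvec (X t) @[t --> G] --> mxvec Y.
Proof.
move=> h; apply: cvg_mx_entries => i j; case/mxvec_indexP: j => k l.
rewrite ord1 mxvecE; under eq_fun do rewrite mxvecE.
exact: cvg_entry.
Qed.

Lemma cvg_vec_mx m n (X : T -> 'rV[F]_(m * n)) (Y : 'rV[F]_(m * n)) :
  X t @[t --> G] --> Y -> vec_mx (X t) @[t --> G] --> vec_mx Y.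
Proof.
move=> h; apply: cvg_mx_entries => i j; rewrite mxE.
under eq_fun do rewrite mxE.
exact: cvg_entry.
Qed.

End MatrixLimits.

(** * Powers of a matrix of spectral radius less than one *)

Lemma geometric_step (C : numFieldType) (u : nat -> C) (z s E : C) :
  `|z| < s -> 0 <= E ->
  (forall k, `|u k.+1 - z * u k| <= E * s ^+ k) ->
  forall k, `|u k| <= (`|u 0%N| + E / (s - `|z|)) * s ^+ k.
Proof.
move=> zs E0 hu; have sz0 : 0 < s - `|z| by rewrite subr_gt0.
have s0 : 0 <= s := le_trans (normr_ge0 z) (ltW zs).
(* [D] dominates the initial value and satisfies [E + |z| D <= s D], which is exactly what the
   induction step consumes. *)
set D := _ + _.
have hE : E <= (s - `|z|) * D.
  by rewrite mulrDr [X in _ + X]mulrC divfK ?gt_eqF // lerDr mulr_ge0 // ltW.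
elim=> [|k IH]; first by rewrite expr0 mulr1 lerDl divr_ge0 // ltW.
rewrite -[u k.+1](subrK (z * u k)) (le_trans (ler_normD _ _)) // normrM.
apply: le_trans (lerD (hu k) (ler_wpM2l (normr_ge0 z) IH)) _.
rewrite mulrA -mulrDl exprS mulrA ler_wpM2r ?exprn_ge0 //.
by rewrite -lerBrDr [_ * s]mulrC -mulrBl.
Qed.

(* The operator  u k |-> u k.+1 - z * u k  corresponds to the factor 'X - z, and
   geometric_step inverts it on geometrically decaying sequences; stripping the
   characteristic polynomial of its factors one at a time starts, by
   Cayley-Hamilton, from the zero sequence. *)
Lemma exp_mx_geometric (C : numClosedFieldType) n (X : 'M[C]_n.+1) (s : C) :
  (forall z, eigenvalue X z -> `|z| < s) ->
  forall i j, exists D, forall k, `|(X ^+ k) i j| <= D * s ^+ k.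
Proof.
move=> hs.
(* The entries of [X ^+ k * p(X)] are dominated by [s ^+ k]; the case [p = 1] is the claim. *)
pose decays (p : {poly C}) := forall i j, exists2 D, 0 <= D &
  forall k, `|horner_mx X ('X^k * p) i j| <= D * s ^+ k.
have strip z p : eigenvalue X z -> decays (('X - z%:P) * p) -> decays p.
  move=> /hs zs dp i j; have [E E0 hE] := dp i j.
  pose u k := horner_mx X ('X^k * p) i j.
  exists (`|u 0%N| + E / (s - `|z|)).
    by rewrite addr_ge0 // divr_ge0 // subr_ge0 ltW.
  apply: geometric_step => // k; apply: le_trans (hE k).
  rewrite /u mulrA mulrBr -exprSr mulrBl -mulrA [_ * (_ * p)]mulrCA.
  by rewrite mul_polyC rmorphB /= horner_mxZ !mxE.
have [r hr] := closed_field_poly_normal (char_poly X).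
have rP z : z \in r -> eigenvalue X z.
  rewrite eigenvalue_root_char hr (monicP (char_poly_monic X)) scale1r.
  by rewrite root_prod_XsubC.
have d0 : decays (\prod_(z <- r) ('X - z%:P) * 1).
  move=> i j; exists 0 => // k.
  have <- : char_poly X = \prod_(z <- r) ('X - z%:P).
    by rewrite [LHS]hr (monicP (char_poly_monic X)) scale1r.
  by rewrite mulr1 rmorphM /= Cayley_Hamilton mulr0 mxE normr0 mul0r.
have strip_all p : decays (\prod_(z <- r) ('X - z%:P) * p) -> decays p.
  elim: r rP {hr d0} p => [|z r IH] rP p; first by rewrite big_nil mul1r.
  rewrite big_cons -mulrA => /strip dp; apply: IH.
    by move=> y yr; apply: rP; rewrite inE yr orbT.
  by apply: dp; apply: rP; rewrite inE eqxx.
move=> i j; have [D _ hD] := strip_all 1 d0 i j; exists D => k.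
by have := hD k; rewrite mulr1 rmorphXn /= horner_mx_X.
Qed.

Section Stability.
Context {F : realType}.

(** The form in which the spectral radius condition enters the Lyapunov theory: it is real and
    visibly invariant under transposition. *)
Definition stable n (X : 'M[F]_n) := X ^+ k @[k --> \oo] --> (0 : 'M[F]_n).

Lemma spectral_radius_ge_norm n (X : 'M[F]_n) (z : F[i]) :
  eigenvalue (map_mx (real_complex F) X) z ->
  `|z| <= (spectral_radius X)%:C%C.
Proof.
move=> Xz; rewrite normc_def.
have -> : Num.sqrt (complex.Re z ^+ 2 + complex.Im z ^+ 2) =
    ComplexField.Normc.normc z by case: (z).
rewrite lecR; apply: ub_le_sup; last by exists z.
have [r hr] := closed_field_poly_normal (char_poly (map_mx (real_complex F) X)).
(* A supremum dominates its set only if the set is bounded; every eigenvalue is a root of the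
   characteristic polynomial, so the sum of the moduli of the roots is a bound. *)
exists (\sum_(y <- r) ComplexField.Normc.normc y) => _ [y /= Xy <-].
have : y \in r.
  move: Xy; rewrite eigenvalue_root_char hr.
  by rewrite (monicP (char_poly_monic _)) scale1r root_prod_XsubC.
move=> yr; rewrite (big_rem y) //= lerDl; apply: sumr_ge0 => -[a b] _.
exact: sqrtr_ge0.
Qed.

Lemma spectral_radius_stable n (X : 'M[F]_n) : spectral_radius X < 1 -> stable X.
Proof.
case: n X => [|n] X rX; first by apply: cvg_mx_entries => -[].
(* A rate strictly between the spectral radius and 1; the maximum with 0 makes it positive. *)
pose s := (Num.max 0 (spectral_radius X) + 1) / 2.
have m1 : Num.max 0 (spectral_radius X) < 1 by rewrite gt_max ltr01 rX.
have m0 : 0 <= Num.max 0 (spectral_radius X) by rewrite le_max lexx.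
have mr : spectral_radius X <= Num.max 0 (spectral_radius X).
  by rewrite le_max lexx orbT.
have [s0 s1 rs] : [/\ 0 < s, s < 1 & spectral_radius X < s].
  by rewrite /s; split; lra.
apply: cvg_mx_entries => i j; rewrite mxE.
have hs z : eigenvalue (map_mx (real_complex F) X) z -> `|z| < s%:C%C.
  by move=> /spectral_radius_ge_norm /le_lt_trans; apply; rewrite ltcR.
have [D hD] := exp_mx_geometric hs i j.
have {}hD k : `|(X ^+ k) i j| <= complex.Re D * s ^+ k.
  have := hD k; rewrite -!rmorphXn /= mxE /=.
  have -> : `|((X ^+ k) i j)%:C%C| = (`|(X ^+ k) i j|)%:C%C.
    by rewrite normc_def /= expr0n addr0 sqrtr_sqr.
  (* The left side and [s ^+ k] are real, so the complex inequality gives the one for the real part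
     of [D]. *)
  by case: (D) => a b; rewrite lecE /= [b * 0]mulr0 subr0 => /andP[].
have hg : geometric (complex.Re D) s k @[k --> \oo] --> (0 : F).
  by apply: cvg_geometric; rewrite ger0_norm // ltW.
apply: norm_cvg0; apply: squeeze_cvgr (cvg_cst 0) hg.
by apply: nearW => k; rewrite normr_ge0 hD.
Qed.

End Stability.

(** * Discrete Lyapunov equations *)

Section Lyapunov.
Context {F : realType}.

Definition quad n (X : 'M[F]_n) (x : 'cV[F]_n) : F := (x^T *m X *m x) 0 0.

Lemma quad_congr m n (S : 'M[F]_m) (Y : 'M[F]_(m, n)) (x : 'cV[F]_n) :
  quad (Y^T *m S *m Y) x = quad S (Y *m x).
Proof. by rewrite /quad trmx_mul !mulmxA. Qed.

Lemma quadD n (X Y : 'M[F]_n) (x : 'cV[F]_n) :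
  quad (X + Y) x = quad X x + quad Y x.
Proof. by rewrite /quad mulmxDr mulmxDl mxE. Qed.

Lemma quad_delta n (X : 'M[F]_n) i : quad X (delta_mx i 0) = X i i.
Proof. by rewrite /quad trmx_delta -rowE -colE !mxE. Qed.

Lemma trmx_exp n (X : 'M[F]_n) k : (X ^+ k)^T = X^T ^+ k.
Proof.
elim: k => [|k IH]; first by rewrite !expr0 trmx1.
by rewrite exprS exprSr -!mulmxE trmx_mul IH.
Qed.

Lemma stable_trmx n (X : 'M[F]_n) : stable X -> stable X^T.
Proof.
move=> /cvg_trmx; rewrite trmx0.
by under eq_fun do rewrite trmx_exp.
Qed.

(** One solution operator for both equations: [lyap_Sigma] is the closed loop with right-hand side
    [1%:M], and [lyap_P] the transposed closed loop with the stage cost. *)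
Definition lyap_sol n (A W : 'M[F]_n) : 'M[F]_n :=
  xget 0 [set X | X = W + A *m X *m A^T].

(* The matrix, on row-major encodings, of  X |-> X - A *m X *m A^T. *)
Definition lyap_mx n (A : 'M[F]_n) : 'M[F]_(n * n) :=
  1%:M - lin_mulmx A *m lin_mulmxr A^T.

Lemma mul_lyap_mx n (A X : 'M[F]_n) :
  mxvec X *m lyap_mx A = mxvec (X - A *m X *m A^T).
Proof. by rewrite mulmxBr mulmx1 mulmxA !mul_vec_lin /= linearB. Qed.

Lemma lyap_eqP n (A W X : 'M[F]_n) :
  X = W + A *m X *m A^T <-> mxvec X *m lyap_mx A = mxvec W.
Proof.
rewrite mul_lyap_mx; split=> [{1}->|]; first by rewrite addrK.
by move=> /(can_inj mxvecK) <-; rewrite subrK.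
Qed.

Lemma lyap_solE n (A W : 'M[F]_n) : lyap_mx A \in unitmx ->
  lyap_sol A W = vec_mx (mxvec W *m invmx (lyap_mx A)).
Proof.
move=> Au; apply: xget_unique => [|Y /= /lyap_eqP hY].
  by apply/lyap_eqP; rewrite vec_mxK mulmxKV.
by rewrite -hY mulmxK // mxvecK.
Qed.

Lemma lyap_sol_eq n (A W : 'M[F]_n) : lyap_mx A \in unitmx ->
  lyap_sol A W = W + A *m lyap_sol A W *m A^T.
Proof.
by move=> Au; apply/lyap_eqP; rewrite lyap_solE // vec_mxK mulmxKV.
Qed.

Lemma lyap_sol_unique n (A W X : 'M[F]_n) : lyap_mx A \in unitmx ->
  X = W + A *m X *m A^T -> X = lyap_sol A W.
Proof.
by move=> Au /lyap_eqP hX; rewrite lyap_solE // -hX mulmxK // mxvecK.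
Qed.

(** A kernel element satisfies [X = A X A^T], hence [X = A^k X (A^k)^T] for all [k], and the right
    side tends to 0. *)
Lemma lyap_mx_unit n (A : 'M[F]_n) : stable A -> lyap_mx A \in unitmx.
Proof.
move=> Ast; rewrite -row_free_unit -kermx_eq0; apply/rowV0P => v /sub_kermxP.
rewrite -[v]vec_mxK; set X := vec_mx v.
rewrite -(linear0 (@mxvec _ _ _)) => /lyap_eqP; rewrite add0r => hX.
have hk k : X = A ^+ k *m X *m (A ^+ k)^T.
  elim: k => [|k IH]; first by rewrite expr0 trmx1 mulmx1 mul1mx.
  by rewrite {1}IH {1}hX exprSr -mulmxE trmx_mul !mulmxA.
suff -> : X = 0 by [].
have h : X @[k --> \oo] --> (0 : 'M[F]_n).
  rewrite (_ : (fun=> X) = fun k => A ^+ k *m X *m (A ^+ k)^T); last exact/funext.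
  have -> : (0 : 'M[F]_n) = 0 *m X *m 0^T by rewrite !mul0mx.
  by apply: cvg_mulmx; [apply: cvg_mulmx => //; exact: cvg_cst | exact: cvg_trmx].
exact: (cvg_unique (@norm_hausdorff _ _) (cvg_cst X) h).
Qed.

Lemma cvg_lyap_mx (T : Type) (G : set_system T) (FG : Filter G) n
    (A : T -> 'M[F]_n) (A' : 'M[F]_n) :
  A t @[t --> G] --> A' -> lyap_mx (A t) @[t --> G] --> lyap_mx A'.
Proof.
move=> hA; apply: cvgB; first exact: cvg_cst.
apply: cvg_mulmx; apply: cvg_mx_entries => i j; rewrite !mxE /=.
  under eq_fun do rewrite !mxE /=.
  apply: cvg_entry; apply: cvg_mxvec; apply: cvg_mulmx => //; exact: cvg_cst.
under eq_fun do rewrite !mxE /=.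
apply: cvg_entry; apply: cvg_mxvec; apply: cvg_mulmx; first exact: cvg_cst.
exact: cvg_trmx.
Qed.

(** Near the limit the Lyapunov matrix stays invertible and the solution is the explicit product
    with its inverse; stability is therefore asked of the limit [A'] alone. *)
Lemma cvg_lyap_sol (T : Type) (G : set_system T) (FG : Filter G) n
    (A W : T -> 'M[F]_n) (A' W' : 'M[F]_n) :
  stable A' -> A t @[t --> G] --> A' -> W t @[t --> G] --> W' ->
  lyap_sol (A t) (W t) @[t --> G] --> lyap_sol A' W'.
Proof.
move=> Ast /cvg_lyap_mx hA hW; rewrite lyap_solE; last exact: lyap_mx_unit.
have H : vec_mx (mxvec (W t) *m invmx (lyap_mx (A t))) @[t --> G] -->
    vec_mx (mxvec W' *m invmx (lyap_mx A')).
  apply: cvg_vec_mx; apply: cvg_mulmx; first exact: cvg_mxvec.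
  by apply: cvg_invmx => //; exact: lyap_mx_unit.
apply: (cvg_trans _ H); apply: near_eq_cvg.
by apply: filterS (near_unitmx (lyap_mx_unit Ast) hA) => t ht; rewrite lyap_solE.
Qed.

Lemma lyap_sol_sym n (A W : 'M[F]_n) :
  stable A -> W^T = W -> (lyap_sol A W)^T = lyap_sol A W.
Proof.
move=> /lyap_mx_unit Au Wsym; apply: lyap_sol_unique => //.
by rewrite {1}lyap_sol_eq // linearD /= Wsym !trmx_mul trmxK mulmxA.
Qed.

(** For the solution [X], [quad X x = quad W x + quad X (A^T x)], so it remains to see that [quad X]
    is nonnegative at [A^T x]. Since [quad W] is nonnegative, [quad X] does not increase along the
    orbit of [A^T], and by stability it tends to 0 there. *)
Lemma lyap_sol_ge n (A W : 'M[F]_n) (x : 'cV[F]_n) :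
  stable A -> (forall y, 0 <= quad W y) -> quad W x <= quad (lyap_sol A W) x.
Proof.
move=> Ast W0; set X := lyap_sol A W.
have hX y : quad X y = quad W y + quad X (A^T *m y).
  rewrite {1}/X lyap_sol_eq ?quadD; last exact: lyap_mx_unit.
  by rewrite -quad_congr trmxK.
have hk k y : quad X (A^T ^+ k *m y) <= quad X y.
  elim: k y => [|k IH] y; first by rewrite expr0 mul1mx.
  rewrite exprSr -mulmxE -mulmxA (le_trans (IH _)) // [leRHS]hX.
  by rewrite lerDr.
rewrite hX lerDl; set y := A^T *m x.
have h : quad X (A^T ^+ k *m y) @[k --> \oo] --> (0 : F).
  have -> : (0 : F) = quad X (0 *m y) by rewrite /quad mul0mx mulmx0 mxE.
  have hy : A^T ^+ k *m y @[k --> \oo] --> 0 *m y.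
    by apply: cvg_mulmx; [exact: stable_trmx | exact: cvg_cst].
  apply: cvg_entry; apply: cvg_mulmx => //; apply: cvg_mulmx.
    exact: cvg_trmx.
  exact: cvg_cst.
by apply: (cvgr_to_le h); apply: nearW => k.
Qed.

(** The operators [X - A X A^T] and [P - A^T P A] are adjoint for the trace pairing. *)
Lemma lyap_duality n (A W Y X P : 'M[F]_n) :
  X = W + A *m X *m A^T -> P = Y + A^T *m P *m A ->
  \tr (Y *m X) = \tr (P *m W).
Proof.
move=> hX hP.
have -> : W = X - A *m X *m A^T by rewrite {1}hX addrK.
have -> : Y = P - A^T *m P *m A by rewrite {1}hP addrK.
rewrite mulmxBr mulmxBl !linearB /=; congr (_ - _).
by rewrite -!mulmxA [LHS]mxtrace_mulC !mulmxA.
Qed.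

(** Duality turns the trace into that of a solution [P] dominating [Y^T S Y], whose diagonal is
    nonnegative and is positive at any nonzero column of [Y]. This positivity makes the equation for
    [K_hat] uniquely solvable. *)
Lemma weighted_trace_gt0 m n (S : 'M[F]_m) (A : 'M[F]_n) (Y : 'M[F]_(m, n)) :
  stable A -> (forall x, x != 0 -> 0 < quad S x) -> Y != 0 ->
  0 < \tr (Y^T *m S *m Y *m lyap_sol A 1%:M).
Proof.
move=> Ast Spos Y0.
have S0 x : 0 <= quad S x.
  by case: (eqVneq x 0) => [->|/Spos/ltW//]; rewrite /quad mulmx0 mxE.
have Z0 x : 0 <= quad (Y^T *m S *m Y) x by rewrite quad_congr.
have ATst := stable_trmx Ast.
set P := lyap_sol A^T (Y^T *m S *m Y).
have hP : P = Y^T *m S *m Y + A^T *m P *m A.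
  by rewrite {1}/P lyap_sol_eq ?trmxK //; exact: lyap_mx_unit.
rewrite (lyap_duality (lyap_sol_eq _ (lyap_mx_unit Ast)) hP) mulmx1.
apply: (@lt_le_trans _ _ (\tr (Y^T *m S *m Y))); last first.
  by apply: ler_sum => i _; rewrite -!quad_delta; exact: lyap_sol_ge.
have [j hj] : exists j, Y *m delta_mx j (0 : 'I_1) != 0.
  apply/existsP; apply: contra_neqT Y0; rewrite negb_exists => /forallP h.
  apply/matrixP => i j; have /eqP/matrixP/(_ i 0) := negbNE (h j).
  by rewrite -colE !mxE.
rewrite /mxtrace (bigD1 j) //= -quad_delta quad_congr ltr_wpDr ?Spos //.
by apply: sumr_ge0 => i _; rewrite -quad_delta.
Qed.

End Lyapunov.

(** * Derivative of the cost *)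

Section CostGradient.
Context {F : realType} {n m : nat}.
Variables (Q : 'M[F]_n) (R : 'M[F]_m).
Hypotheses (Qsym : Q^T = Q) (Rsym : R^T = R).

Definition stage_cost (K : 'M[F]_(m, n)) : 'M[F]_n := Q + K^T *m R *m K.

(** The weight of the second-order term when the gain of one mode is perturbed; it is also the
    coefficient of the unknown in the equation for [K_hat]. *)
Definition curvature (A : 'M[F]_n) (B : 'M[F]_(n, m)) (K : 'M[F]_(m, n)) :
    'M[F]_m :=
  R + B^T *m lyap_P Q R A B K *m B.

Lemma lyap_SigmaE (A : 'M[F]_n) (B : 'M[F]_(n, m)) (K : 'M[F]_(m, n)) :
  lyap_Sigma A B K = lyap_sol (closed_loop A B K) 1%:M.
Proof. by []. Qed.

Lemma lyap_PE (A : 'M[F]_n) (B : 'M[F]_(n, m)) (K : 'M[F]_(m, n)) :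
  lyap_P Q R A B K = lyap_sol (closed_loop A B K)^T (stage_cost K).
Proof. by rewrite /lyap_sol trmxK. Qed.

Lemma stage_cost_sym K : (stage_cost K)^T = stage_cost K.
Proof. by rewrite linearD /= Qsym !trmx_mul trmxK Rsym mulmxA. Qed.

Lemma congr_perturb p q (Z : 'M[F]_p) (U V : 'M[F]_(p, q)) (h : F) :
  (h *: V + U)^T *m Z *m (h *: V + U) =
  U^T *m Z *m U + h *: (V^T *m Z *m U + U^T *m Z *m V)
    + h ^+ 2 *: (V^T *m Z *m V).
Proof.
have -> : (h *: V + U)^T = h *: V^T + U^T by rewrite linearD linearZ.
rewrite !mulmxDl !mulmxDr -!scalemxAl -!scalemxAr scalerA.
by rewrite expr2 scalerDr -addrA [LHS]addrC; congr (_ + _); rewrite addrA addrC.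
Qed.

Section Mode.
Variables (A : 'M[F]_n) (B : 'M[F]_(n, m)).

Local Notation cl := (closed_loop A B).
Local Notation P := (lyap_P Q R A B).
Local Notation Sg := (lyap_Sigma A B).

(** Multiplied on the right by [lyap_Sigma], this is half the gradient of the cost of one mode. *)
Definition half_slope (K : 'M[F]_(m, n)) : 'M[F]_(m, n) :=
  curvature A B K *m K + B^T *m P K *m A.

Lemma half_slopeE K : half_slope K = R *m K + B^T *m P K *m cl K.
Proof.
rewrite /half_slope /curvature mulmxDl mulmxDr !mulmxA -addrA.
by rewrite [X in _ + X]addrC.
Qed.

Lemma lyap_P_sym K : stable (cl K) -> (P K)^T = P K.
Proof.
move=> st; rewrite lyap_PE; apply: lyap_sol_sym; first exact: stable_trmx.
exact: stage_cost_sym.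
Qed.

(* Both costs are compared with the trace of P K: at K this is duality, and at
   the perturbed gain duality is applied to P K, which solves there the Lyapunov
   equation with right-hand side P K - cl(K')^T P K cl(K'). *)
Lemma mode_cost_perturb K E h : stable (cl K) ->
  lyap_mx (cl (h *: E + K)) \in unitmx ->
  \tr (stage_cost (h *: E + K) *m Sg (h *: E + K))
    - \tr (stage_cost K *m Sg K) =
  h * (\tr ((E^T *m half_slope K + (half_slope K)^T *m E)
              *m Sg (h *: E + K))
       + h * \tr (E^T *m curvature A B K *m E *m Sg (h *: E + K))).
Proof.
move=> st un'; set K' := h *: E + K.
have un := lyap_mx_unit st.
have hP : P K = stage_cost K + (cl K)^T *m P K *m cl K.
  rewrite {1}lyap_PE lyap_sol_eq ?lyap_PE ?trmxK //.
  exact: lyap_mx_unit (stable_trmx st).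
have hS : Sg K = 1%:M + cl K *m Sg K *m (cl K)^T by exact: lyap_sol_eq.
have hS' : Sg K' = 1%:M + cl K' *m Sg K' *m (cl K')^T by exact: lyap_sol_eq.
rewrite (lyap_duality hS hP).
pose Y := P K - (cl K')^T *m P K *m cl K'.
have hY : P K = Y + (cl K')^T *m P K *m cl K' by rewrite subrK.
rewrite -(lyap_duality hS' hY) -linearB /= -mulmxBl.
set X := _ + _ *m E; set Z := E^T *m _ *m E.
have -> : h * (\tr (X *m Sg K') + h * \tr (Z *m Sg K')) =
    \tr ((h *: X + h ^+ 2 *: Z) *m Sg K').
  rewrite [X in _ = \tr X]mulmxDl -[(h *: X) *m _]scalemxAl.
  by rewrite -[(_ *: Z) *m _]scalemxAl linearD /= !linearZ /= expr2; ring.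
congr (\tr (_ *m _)).
have clK' : cl K' = h *: (B *m E) + cl K.
  by rewrite /closed_loop mulmxDr -scalemxAr addrCA.
rewrite /Y clK' /stage_cost !congr_perturb {1}hP /stage_cost.
rewrite (_ : X =
    (E^T *m R *m K + K^T *m R *m E) +
    ((B *m E)^T *m P K *m cl K + (cl K)^T *m P K *m (B *m E))); last first.
  rewrite /X; have -> : (half_slope K)^T = K^T *m R + (cl K)^T *m P K *m B.
    by rewrite half_slopeE linearD /= !trmx_mul Rsym lyap_P_sym // trmxK mulmxA.
  by rewrite half_slopeE mulmxDr mulmxDl trmx_mul !mulmxA addrACA.
have -> : Z =
    E^T *m R *m E + (B *m E)^T *m P K *m (B *m E).
  by rewrite /Z mulmxDr mulmxDl trmx_mul !mulmxA.
(* Both sides are now polynomials in [h]. With [k + a] the stage cost at [K] and [b] the closed-loop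
   term, the Lyapunov equation of [P K] cancels the terms of order zero. *)
have cancel (k a b c d x y : 'M[F]_n) :
    k + (a + h *: x + h ^+ 2 *: y) - (k + a + b - (b + h *: c + h ^+ 2 *: d)) =
    h *: (x + c) + h ^+ 2 *: (y + d).
  by apply/matrixP => i j; rewrite !mxE; ring.
exact: cancel.
Qed.

(** After division by [h], the exact perturbation formula leaves a first-order trace against [Sg],
    which is continuous in the gain, and a term that vanishes with [h]. The two transposed halves of
    the first trace agree because [Sg K] is symmetric, whence the factor 2. *)
Lemma cvg_mode_cost K E : stable (cl K) ->
  h^-1 * (\tr (stage_cost (h *: E + K) *m Sg (h *: E + K))
            - \tr (stage_cost K *m Sg K)) @[h --> 0^'] -->
  2 * \tr (E^T *m (half_slope K *m Sg K)).
Proof.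
move=> st.
have hK' : h *: E + K @[h --> (0 : F)^'] --> K.
  rewrite -[X in _ --> X]add0r -(scale0r E).
  apply: cvgD; last exact: cvg_cst.
  by apply: cvgZr_tmp; apply: cvg_within_filter; exact: cvg_id.
have hcl : cl (h *: E + K) @[h --> (0 : F)^'] --> cl K.
  apply: cvgD; first exact: cvg_cst.
  by apply: cvg_mulmx => //; exact: cvg_cst.
have hSg : Sg (h *: E + K) @[h --> (0 : F)^'] --> Sg K.
  by apply: cvg_lyap_sol => //; exact: cvg_cst.
have hun : \forall h \near (0 : F)^', lyap_mx (cl (h *: E + K)) \in unitmx.
  by apply: near_unitmx (lyap_mx_unit st) _; exact: cvg_lyap_mx.
have SgT : (Sg K)^T = Sg K by apply: lyap_sol_sym => //; exact: trmx1.
set X := E^T *m half_slope K + (half_slope K)^T *m E.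
set Z := E^T *m curvature A B K *m E.
have -> : 2 * \tr (E^T *m (half_slope K *m Sg K)) =
    \tr (X *m Sg K) + 0 * \tr (Z *m Sg K).
  rewrite mul0r addr0 mulr_natl mulr2n [X *m _]mulmxDl mxtraceD mulmxA.
  congr (_ + _).
  by rewrite -mxtrace_tr !trmx_mul trmxK SgT mxtrace_mulC.
have H : \tr (X *m Sg (h *: E + K)) + h * \tr (Z *m Sg (h *: E + K))
    @[h --> (0 : F)^'] --> \tr (X *m Sg K) + 0 * \tr (Z *m Sg K).
  apply: cvgD; last apply: cvgM.
  - by apply: cvg_mxtrace; apply: cvg_mulmx => //; exact: cvg_cst.
  - by apply: cvg_within_filter; exact: cvg_id.
  - by apply: cvg_mxtrace; apply: cvg_mulmx => //; exact: cvg_cst.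
apply: (cvg_trans _ H); apply: near_eq_cvg.
have h0 : \forall h \near (0 : F)^', h != 0 by exact: nbhs_dnbhs_neq.
by near=> h; rewrite mode_cost_perturb ?mulKf //; near: h.
Unshelve. all: by end_near.
Qed.

End Mode.
End CostGradient.

(** * Gradient of the averaged cost and the equation for the improved gain *)

Section Gradient.
Context {F : realType} {n m M : nat}.
Variables (A : 'I_M -> 'M[F]_n) (B : 'I_M -> 'M[F]_(n, m)).
Variables (Q : 'M[F]_n) (R : 'M[F]_m).
Hypotheses (Qpsd : sym_psd Q) (Rpd : sym_pd R).

Lemma K_js_stable K j : K_js A B K -> stable (closed_loop (A j) (B j) K).
Proof. by move=> /(_ j) /spectral_radius_stable. Qed.

Lemma derive_J_SA K E : K_js A B K ->
  'D_E (J_SA Q R A B) K =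
  M%:R^-1 * \sum_(j < M)
    2 * \tr (E^T *m (half_slope Q R (A j) (B j) K *m lyap_Sigma (A j) (B j) K)).
Proof.
case: Qpsd Rpd => Qs _ [Rs _] hK; apply: cvg_lim => //.
apply: (@cvg_trans _ ((fun h => M%:R^-1 * \sum_(j < M) h^-1 *
    (\tr (stage_cost Q R (h *: E + K) *m lyap_Sigma (A j) (B j) (h *: E + K))
     - \tr (stage_cost Q R K *m lyap_Sigma (A j) (B j) K))) @ (0 : F)^')).
  apply: near_eq_cvg; apply: nearW => h /=.
  rewrite -mulr_sumr sumrB /J_SA /= -mulrBr.
  by rewrite [RHS]mulrCA.
apply: cvgM; first exact: cvg_cst.
apply: cvg_bigsum => j _; apply: cvg_mode_cost => //.
exact: K_js_stable.
Qed.

Lemma gradient_J_SA K : K_js A B K -> differentiable (J_SA Q R A B) K ->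
  gradient (J_SA Q R A B) K =
  (2 / M%:R) *: \sum_(j < M)
    (half_slope Q R (A j) (B j) K *m lyap_Sigma (A j) (B j) K).
Proof.
move=> hK dK; apply/matrixP => a b; rewrite !mxE -deriveE // derive_J_SA //.
rewrite -mulr_sumr summxE mulrA [_ * 2]mulrC; congr (_ * _).
apply: eq_bigr => j _; set Y := _ *m lyap_Sigma _ _ _.
(* The trace of [(delta_mx a b)^T *m Y] is the entry of [Y] at [(a, b)]. *)
rewrite /mxtrace (bigD1 b) //= big1 ?addr0 => [|c cb].
  rewrite mxE (bigD1 a) //= big1 ?addr0 => [|d da].
    by rewrite !mxE !eqxx mul1r.
  by rewrite !mxE (negbTE da) mul0r.
rewrite mxE big1 // => d _.
by rewrite !mxE (negbTE cb) andbF mul0r.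
Qed.

Lemma lyap_P_psd K j x : K_js A B K ->
  0 <= quad (lyap_P Q R (A j) (B j) K) x.
Proof.
case: Qpsd Rpd => Qs Q0 [Rs R0] hK; rewrite lyap_PE.
have W0 y : 0 <= quad (stage_cost Q R K) y.
  rewrite quadD quad_congr addr_ge0 //; first exact: Q0.
  case: (eqVneq (K *m y) 0) => [->|/R0/ltW //].
  by rewrite /quad mulmx0 mxE.
apply: le_trans (W0 x) _; apply: lyap_sol_ge => //.
by apply: stable_trmx; exact: K_js_stable.
Qed.

Lemma curvature_pd K j x : K_js A B K -> x != 0 ->
  0 < quad (curvature Q R (A j) (B j) K) x.
Proof.
move=> hK x0; rewrite quadD quad_congr ltr_pwDl //; last exact: lyap_P_psd.
by case: Rpd => _; exact.
Qed.

(** The linear part of the equation for [K_hat], as a matrix acting on row-major encodings. *)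
Definition improvement_mx K : 'M[F]_(m * n) :=
  \sum_(j < M) lin_mulmx (curvature Q R (A j) (B j) K)
                 *m lin_mulmxr (lyap_Sigma (A j) (B j) K).

Lemma mul_improvement_mx K (X : 'M[F]_(m, n)) :
  mxvec X *m improvement_mx K =
  mxvec (\sum_(j < M)
           curvature Q R (A j) (B j) K *m X *m lyap_Sigma (A j) (B j) K).
Proof.
rewrite mulmx_sumr linear_sum /=; apply: eq_bigr => j _.
by rewrite mulmxA !mul_vec_lin.
Qed.

(** Pairing the image of a kernel element [X] with [X] itself gives a sum of traces that are all
    positive if [X] is nonzero; [0 < M] provides at least one term. *)
Lemma improvement_mx_unit K : (0 < M)%N -> K_js A B K ->
  improvement_mx K \in unitmx.
Proof.
move=> M0 hK; rewrite -row_free_unit -kermx_eq0; apply/rowV0P => v /sub_kermxP.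
rewrite -[v]vec_mxK mul_improvement_mx => h; set X := vec_mx v in h *.
suff -> : X = 0 by rewrite linear0.
apply/eqP; apply: contraTT isT => X0.
have {}h : \sum_(j < M)
    curvature Q R (A j) (B j) K *m X *m lyap_Sigma (A j) (B j) K = 0.
  by apply: (can_inj mxvecK); rewrite h; exact/esym/linear0.
have hpos j : 0 < \tr (X^T *m curvature Q R (A j) (B j) K *m X
                         *m lyap_Sigma (A j) (B j) K).
  rewrite lyap_SigmaE; apply: weighted_trace_gt0 => //; first exact: K_js_stable.
  by move=> x; exact: curvature_pd.
have : 0 < \sum_(j < M) \tr (X^T *m curvature Q R (A j) (B j) K *m X
                               *m lyap_Sigma (A j) (B j) K).
  rewrite (bigD1 (Ordinal M0)) //= ltr_pwDl // sumr_ge0 // => j _.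
  exact: ltW.
under eq_bigr do rewrite -!mulmxA.
rewrite -raddf_sum -mulmx_sumr.
under eq_bigr do rewrite mulmxA.
by rewrite h mulmx0 raddf0 ltxx.
Qed.

(** [xget] returns a solution once one exists, and inverting [improvement_mx] exhibits one. *)
Lemma K_hatP K : (0 < M)%N -> K_js A B K ->
  \sum_(j < M) ((curvature Q R (A j) (B j) K *m K_hat Q R A B K
    + (B j)^T *m lyap_P Q R (A j) (B j) K *m A j)
       *m lyap_Sigma (A j) (B j) K) = 0.
Proof.
move=> M0 hK; have un := improvement_mx_unit M0 hK.
pose Y := \sum_(j < M) ((B j)^T *m lyap_P Q R (A j) (B j) K *m A j)
                         *m lyap_Sigma (A j) (B j) K.
pose X : 'M[F]_(m, n) := vec_mx (- mxvec Y *m invmx (improvement_mx K)).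
apply: (@xgetPex _ 0 [set Kh | \sum_(j < M)
  ((curvature Q R (A j) (B j) K *m Kh
    + (B j)^T *m lyap_P Q R (A j) (B j) K *m A j)
       *m lyap_Sigma (A j) (B j) K) = 0]).
exists X => /=; under eq_bigr do rewrite mulmxDl.
rewrite big_split /= -/Y; apply/eqP; rewrite addr_eq0; apply/eqP.
apply: (can_inj mxvecK); rewrite -mul_improvement_mx vec_mxK mulmxKV //.
by rewrite linearN.
Qed.

(** Subtracting the equation for [K_hat] from the gradient formula cancels the terms [B^T P A] and
    leaves the curvatures applied to [K - K_hat]. *)
Lemma gradient_Delta K : (0 < M)%N -> K_js A B K ->
  differentiable (J_SA Q R A B) K ->
  gradient (J_SA Q R A B) K =
  - (2 / M%:R) *: \sum_(j < M) (curvature Q R (A j) (B j) K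
      *m Delta Q R A B K *m lyap_Sigma (A j) (B j) K).
Proof.
move=> M0 hK dK; rewrite gradient_J_SA // scaleNr -scalerN; congr (_ *: _).
rewrite -[LHS]subr0 -[X in _ - X](K_hatP M0 hK) -sumrB -sumrN.
apply: eq_bigr => j _.
rewrite -mulmxBl -mulNmx; congr (_ *m _).
by rewrite /half_slope opprD addrACA subrr addr0 -mulmxBr -mulmxN opprB.
Qed.

End Gradient.

(** * Comparison of the gradient with the improvement direction *)

Section Norms.
Context {F : realType}.

Lemma frob_innerE m n (X Y : 'M[F]_(m, n)) :
  frob_inner X Y = \sum_i \sum_j X i j * Y i j.
Proof.
rewrite /frob_inner /mxtrace exchange_big /=; apply: eq_bigr => j _.
by rewrite mxE; apply: eq_bigr => i _; rewrite mxE.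
Qed.

Lemma frob_inner_ge0 m n (X : 'M[F]_(m, n)) : 0 <= frob_inner X X.
Proof.
rewrite frob_innerE; apply: sumr_ge0 => i _; apply: sumr_ge0 => j _.
by rewrite -expr2 sqr_ge0.
Qed.

Lemma sqr_frob_norm m n (X : 'M[F]_(m, n)) : frob_norm X ^+ 2 = frob_inner X X.
Proof. by rewrite sqr_sqrtr // frob_inner_ge0. Qed.

Lemma frob_norm_ge0 m n (X : 'M[F]_(m, n)) : 0 <= frob_norm X.
Proof. exact: sqrtr_ge0. Qed.

Lemma sqr_entry_le_frob m n (X : 'M[F]_(m, n)) i j :
  X i j ^+ 2 <= frob_inner X X.
Proof.
rewrite frob_innerE (bigD1 i) //= (bigD1 j) //= -expr2 -addrA lerDl.
by rewrite addr_ge0 // sumr_ge0 // => k _; rewrite ?sumr_ge0 // => *;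
  rewrite -expr2 sqr_ge0.
Qed.

Lemma frob_inner_gt0 m n (X : 'M[F]_(m, n)) : X != 0 -> 0 < frob_inner X X.
Proof.
apply: contra_neqT; rewrite -leNgt => h; apply/matrixP => i j; rewrite mxE.
have := le_trans (sqr_entry_le_frob X i j) h.
by rewrite le_eqVlt ltNge sqr_ge0 orbF sqrf_eq0 => /eqP.
Qed.

Lemma frob_innerC m n (X Y : 'M[F]_(m, n)) : frob_inner X Y = frob_inner Y X.
Proof. by rewrite /frob_inner -mxtrace_tr trmx_mul trmxK. Qed.

Lemma frob_innerDl m n (X Y Z : 'M[F]_(m, n)) :
  frob_inner (X + Y) Z = frob_inner X Z + frob_inner Y Z.
Proof. by rewrite /frob_inner linearD /= mulmxDl mxtraceD. Qed.

Lemma frob_innerZl m n a (X Z : 'M[F]_(m, n)) :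
  frob_inner (a *: X) Z = a * frob_inner X Z.
Proof. by rewrite /frob_inner linearZ /= -scalemxAl mxtraceZ. Qed.

Lemma frob_normZ m n a (X : 'M[F]_(m, n)) :
  frob_norm (a *: X) = `|a| * frob_norm X.
Proof.
rewrite /frob_norm frob_innerZl frob_innerC frob_innerZl mulrA.
by rewrite sqrtrM ?sqrtr_sqr // -expr2 sqr_ge0.
Qed.

(** Cauchy-Schwarz: with [x], [y], [z] the inner products of [X] with itself, [Y] with itself and
    [X] with [Y], the matrix [y X - z Y] has squared norm [y (x y - z^2)]. *)
Lemma frob_inner_le m n (X Y : 'M[F]_(m, n)) :
  frob_inner X Y <= frob_norm X * frob_norm Y.
Proof.
have [->|Y0] := eqVneq Y 0.
  rewrite /frob_inner mulmx0 mxtrace0.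
  by rewrite mulr_ge0 // frob_norm_ge0.
have y0 := frob_inner_gt0 Y0.
rewrite /frob_norm -sqrtrM ?frob_inner_ge0 //.
apply: le_trans (ler_norm _) _; rewrite -sqrtr_sqr ler_wsqrtr //.
have := frob_inner_ge0 (frob_inner Y Y *: X + (- frob_inner X Y) *: Y).
rewrite frob_innerDl !frob_innerZl ![frob_inner _ (_ + _)]frob_innerC.
rewrite !frob_innerDl !frob_innerZl (frob_innerC Y X).
set x := frob_inner X X; set y := frob_inner Y Y in y0 *; set z := frob_inner X Y.
move=> h; rewrite -subr_ge0 -(pmulr_rge0 _ y0).
by apply: le_trans h _; rewrite le_eqVlt; apply/orP; left; apply/eqP; ring.
Qed.

(** The norm here is the largest modulus of an entry. Compactness gives bounds in this norm, and the
    comparisons that follow carry them over to the Frobenius norm. *)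
Lemma normr_entry_le m n (X : 'M[F]_(m, n)) i j : `|X i j| <= `|X|.
Proof.
rewrite [leRHS]/Num.Def.normr /= mx_normrE.
exact: (le_bigmax _ (fun k : 'I_m * 'I_n => `|X k.1 k.2|) (i, j)).
Qed.

Lemma mx_norm_le m n (X : 'M[F]_(m, n)) c :
  0 <= c -> (forall i j, `|X i j| <= c) -> `|X| <= c.
Proof.
move=> c0 h; rewrite [leLHS]/Num.Def.normr /= mx_normrE.
by apply: bigmax_le => // -[i j] _; exact: h.
Qed.

Lemma mx_norm_mul m n p (X : 'M[F]_(m, n)) (Y : 'M[F]_(n, p)) :
  `|X *m Y| <= n%:R * `|X| * `|Y|.
Proof.
apply: mx_norm_le => [|i j]; first by rewrite !mulr_ge0.
rewrite mxE (le_trans (ler_norm_sum _ _ _)) //.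
apply: (@le_trans _ _ (\sum_(k < n) `|X| * `|Y|)).
  by apply: ler_sum => k _; rewrite normrM ler_pM // normr_entry_le.
by rewrite sumr_const card_ord -[leLHS]mulr_natl mulrA.
Qed.

Lemma mx_norm_le_frob m n (X : 'M[F]_(m, n)) : `|X| <= frob_norm X.
Proof.
apply: mx_norm_le => [|i j]; first exact: frob_norm_ge0.
by rewrite -sqrtr_sqr ler_wsqrtr // sqr_entry_le_frob.
Qed.

Lemma sqr_frob_norm_le m n (X : 'M[F]_(m, n)) :
  frob_norm X ^+ 2 <= (m * n)%:R * `|X| ^+ 2.
Proof.
rewrite sqr_frob_norm frob_innerE.
apply: (@le_trans _ _ (\sum_(i < m) \sum_(j < n) `|X| ^+ 2)).
  apply: ler_sum => i _; apply: ler_sum => j _.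
  by rewrite -expr2 -real_normK ?num_real // lerXn2r ?nnegrE // normr_entry_le.
by rewrite !sumr_const !card_ord -mulrnA -[leLHS]mulr_natl mulnC.
Qed.

Lemma compact_norm_bound m n p q (S : set 'M[F]_(m, n))
    (f : 'M[F]_(m, n) -> 'M[F]_(p, q)) :
  compact S -> (forall K, S K -> f @ K --> f K) ->
  exists2 c, 0 < c & forall K, S K -> `|f K| <= c.
Proof.
move=> Sc fc; have fS : compact (f @` S).
  apply: continuous_compact => //; apply: continuous_in_subspaceT => K.
  by rewrite inE => /fc.
have [c c0 hc] := pinfty_ex_gt0 (compact_bounded fS).
by exists c => // K SK; apply: hc; exists K.
Qed.

End Norms.

(** * Uniform bounds over a compact set of stabilizing gains *)

Section GradientBound.
Context {F : realType} {n m M : nat}.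
Variables (A : 'I_M -> 'M[F]_n) (B : 'I_M -> 'M[F]_(n, m)).
Variables (Q : 'M[F]_n) (R : 'M[F]_m).

Section Limits.
Context {T : Type} {G : set_system T} {FG : Filter G}.
Variables (X : T -> 'M[F]_(m, n)) (K : 'M[F]_(m, n)) (j : 'I_M).
Hypotheses (hK : K_js A B K) (hX : X t @[t --> G] --> K).

Lemma cvg_closed_loop :
  closed_loop (A j) (B j) (X t) @[t --> G] --> closed_loop (A j) (B j) K.
Proof.
apply: cvgD; first exact: cvg_cst.
by apply: cvg_mulmx => //; exact: cvg_cst.
Qed.

Lemma cvg_lyap_Sigma :
  lyap_Sigma (A j) (B j) (X t) @[t --> G] --> lyap_Sigma (A j) (B j) K.
Proof.
apply: cvg_lyap_sol; last exact: cvg_cst.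
  exact: K_js_stable hK.
exact: cvg_closed_loop.
Qed.

Lemma cvg_curvature :
  curvature Q R (A j) (B j) (X t) @[t --> G] --> curvature Q R (A j) (B j) K.
Proof.
apply: cvgD; first exact: cvg_cst.
apply: cvg_mulmx; last exact: cvg_cst.
apply: cvg_mulmx; first exact: cvg_cst.
rewrite lyap_PE; under eq_fun do rewrite lyap_PE.
apply: cvg_lyap_sol.
- by apply: stable_trmx; exact: K_js_stable hK.
- by apply: cvg_trmx; exact: cvg_closed_loop.
apply: cvgD; first exact: cvg_cst.
apply: cvg_mulmx => //.
by apply: cvg_mulmx; [exact: cvg_trmx | exact: cvg_cst].
Qed.

End Limits.

Lemma gradient_le_Delta (S : set 'M[F]_(m, n)) :
  sym_psd Q -> sym_pd R -> (0 < M)%N -> compact S -> S `<=` K_js A B ->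
  (forall K, S K -> differentiable (J_SA Q R A B) K) ->
  exists2 C, 0 < C & forall K, S K ->
    frob_norm (gradient (J_SA Q R A B) K) ^+ 2
      <= C * frob_norm (Delta Q R A B K) ^+ 2.
Proof.
move=> Qpsd Rpd M0 Sc SK Jd.
have /choice[c hc] : forall j, exists c, 0 < c /\ forall K, S K ->
    `|curvature Q R (A j) (B j) K| <= c.
  move=> j; have h K : S K -> curvature Q R (A j) (B j) @ K -->
      curvature Q R (A j) (B j) K.
    by move=> /SK hK; exact: (@cvg_curvature _ _ (nbhs_filter K) id).
  by have [c c0 hc] := compact_norm_bound Sc h; exists c.
have /choice[s hs] : forall j, exists c, 0 < c /\ forall K, S K ->
    `|lyap_Sigma (A j) (B j) K| <= c.
  move=> j; have h K : S K -> lyap_Sigma (A j) (B j) @ K -->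
      lyap_Sigma (A j) (B j) K.
    by move=> /SK hK; exact: (@cvg_lyap_Sigma _ _ (nbhs_filter K) id).
  by have [s s0 hs] := compact_norm_bound Sc h; exists s.
(* [D] bounds the ratio of the entrywise norm of the gradient to the Frobenius norm of [Delta]; the
   factors [n] and [m] come from [mx_norm_mul], used twice. *)
pose D := 2 / M%:R * \sum_(j < M) (n%:R * (m%:R * c j) * s j).
have D0 : 0 <= D.
  rewrite mulr_ge0 // sumr_ge0 // => j _.
  by rewrite !mulr_ge0 //; [case: (hc j) => /ltW | case: (hs j) => /ltW].
(* The added 1 keeps the constant positive even when the first term vanishes. *)
exists ((m * n)%:R * D ^+ 2 + 1) => [|K hK].
  by rewrite ltr_wpDl // mulr_ge0 // sqr_ge0.
apply: le_trans (sqr_frob_norm_le _) _.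
set d := frob_norm (Delta Q R A B K).
apply: (@le_trans _ _ ((m * n)%:R * D ^+ 2 * d ^+ 2)); last first.
  by rewrite ler_wpM2r ?sqr_ge0 // lerDl.
rewrite -mulrA -exprMn ler_wpM2l // lerXn2r ?nnegrE //.
  by rewrite mulr_ge0 // frob_norm_ge0.
rewrite gradient_Delta //; [|exact: SK|exact: Jd].
rewrite normrZ normrN ger0_norm // /D -[leRHS]mulrA ler_wpM2l // mulr_suml.
rewrite (le_trans (ler_norm_sum _ _ _)) //; apply: ler_sum => j _.
have [cj0 cj] := hc j; have [sj0 sj] := hs j.
apply: le_trans (mx_norm_mul _ _) _.
have -> : n%:R * (m%:R * c j) * s j * d = n%:R * (m%:R * c j * d) * s j by ring.
apply: ler_pM => //; [ | exact: sj].
rewrite ler_wpM2l //; apply: le_trans (mx_norm_mul _ _) _.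
apply: ler_pM => //; [ | exact: mx_norm_le_frob].
by rewrite ler_wpM2l // cj.
Qed.

End GradientBound.

(** * Descent along a segment *)

Section Descent.
Context {F : realType} {m n : nat}.
Implicit Types (f : 'M[F]_(m, n) -> F) (K D : 'M[F]_(m, n)).

Lemma diff_gradient f K D : 'd f K D = frob_inner (gradient f K) D.
Proof.
rewrite {1}[D]matrix_sum_delta linear_sum frob_innerE; apply: eq_bigr => i _.
by rewrite linear_sum; apply: eq_bigr => j _; rewrite linearZ /= mxE mulrC.
Qed.

(** The difference quotients of the restriction to the line are those of [f] in the direction
    [D]. *)
Lemma is_derive_line f K D (a : F) : differentiable f (K + a *: D) ->
  is_derive a 1 (fun b => f (K + b *: D))
    (frob_inner (gradient f (K + a *: D)) D).
Proof.
move=> df; rewrite -diff_gradient -deriveE //.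
have e : (fun h : F => h^-1 *: ((f \o shift (K + a *: D)) (h *: D)
             - f (K + a *: D))) =
         (fun h : F => h^-1 *: (((fun b => f (K + b *: D)) \o shift a) (h *: 1)
             - f (K + a *: D))).
  apply/funext => h /=; congr (_ *: (f _ - _)).
  by rewrite [h *: 1]mulr1 scalerDl addrCA.
have : derivable f (K + a *: D) D by exact: diff_derivable.
rewrite /derivable e => dl.
by split => //; rewrite /derive -e.
Qed.

Variables (f : 'M[F]_(m, n) -> F) (U : set 'M[F]_(m, n)) (gamma L c alpha : F).
Let S := [set K | U K /\ f K <= gamma].
Hypotheses (Sclosed : closed S) (L0 : 0 < L) (alpha0 : 0 <= alpha).
Hypothesis alpha_le : alpha <= c / L.
Hypothesis df : forall K, S K -> differentiable f K.
Hypothesis smooth : smooth_on L f S.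
Variables (K D : 'M[F]_(m, n)).
Hypothesis SK : S K.
Hypothesis descent :
  frob_inner (gradient f K) D <= - c * frob_norm D ^+ 2.
Hypothesis UKD : forall a, 0 <= a <= alpha -> U (K + a *: D).

(** The descent condition bounds the slope at [K], and Cauchy-Schwarz with the Lipschitz bound
    controls its change along the segment. The Lipschitz bound holds only inside [S], so the segment
    must first be shown to stay there. *)
Lemma slope_le a : 0 <= a -> S (K + a *: D) ->
  frob_inner (gradient f (K + a *: D)) D <= (L * a - c) * frob_norm D ^+ 2.
Proof.
move=> a0 Sa; rewrite -[gradient f (K + a *: D)](subrK (gradient f K)).
rewrite frob_innerDl mulrBl -mulNr lerD //.
apply: le_trans (frob_inner_le _ _) _.
rewrite expr2 mulrA ler_wpM2r ?frob_norm_ge0 //.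
have := smooth Sa SK.
have -> : K + a *: D - K = a *: D by rewrite addrC addKr.
by rewrite frob_normZ ger0_norm // mulrA.
Qed.

(* Continuation: the segment cannot leave the closed sublevel set at a last
   parameter s < alpha, since f is differentiable there with negative slope. *)
Lemma segment_in_sublevel a : 0 <= a <= alpha -> S (K + a *: D).
Proof.
have [->|D0] := eqVneq D 0; first by rewrite scaler0 addr0.
have d0 : 0 < frob_norm D ^+ 2 by rewrite sqr_frob_norm frob_inner_gt0.
(* Parameters up to which the whole initial segment lies in [S]; the aim is that their supremum is
   [alpha]. *)
pose T := [set t | 0 <= t <= alpha /\
  forall b, 0 <= b <= t -> S (K + b *: D)].
have T0 : T 0.
  split=> [|b]; first by rewrite lexx.
  by rewrite -eq_le => /eqP <-; rewrite scale0r addr0.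
have Tub : ubound T alpha by move=> t [/andP[]].
have hT : has_sup T by split; [exists 0 | exists alpha].
set s := sup T.
have s0 : 0 <= s by apply: sup_upper_bound.
have sa : s <= alpha by apply: ge_sup => //; exists 0.
have below b : 0 <= b < s -> S (K + b *: D).
  move=> /andP[b0 bs]; have [t [_ tT] bt] := sup_gt (ex_intro _ _ T0) bs.
  by apply: tT; rewrite b0 ltW.
have Ss : S (K + s *: D).
  have [->|s1] := eqVneq s 0; first by rewrite scale0r addr0.
  have s2 : 0 < s by rewrite lt_neqAle eq_sym s1.
  apply: (@closed_cvg _ _ (s^'-) _ (fun b => K + b *: D) S) => //.
    near=> b; apply: below; apply/andP; split; near: b.
      exact: nbhs_left_ge.
    exact: nbhs_left_lt.
  apply: cvgD; first exact: cvg_cst.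
  by apply: cvgZr_tmp; apply: cvg_within_filter; exact: cvg_id.
have sE : s = alpha.
  apply/eqP; rewrite eq_le sa leNgt; apply/negP => sl.
  (* Strict because [s < alpha <= c / L] gives [L * s < c]. *)
  have slope : frob_inner (gradient f (K + s *: D)) D < 0.
    apply: le_lt_trans (slope_le s0 Ss) _; rewrite pmulr_llt0 // subr_lt0.
    by rewrite mulrC -ltr_pdivlMr // (lt_le_trans sl).
  have [dl de] := is_derive_line (df Ss).
  move: slope; rewrite -de => slope.
  have near_dec := cvgr_lt _ dl 0 slope.
  have [e /= e0 he] := near_dec.
  (* A positive extension that stays inside the radius [e] where the difference quotients are
     negative and does not pass [alpha]; it puts [s + r] in [T], against the choice of [s]. *)
  pose r := Num.min (e / 2) (alpha - s).
  have r0 : 0 < r by rewrite lt_min divr_gt0 // subr_gt0.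
  have : T (s + r).
    split; first by rewrite addr_ge0 ?(ltW r0) //= -lerBrDl ge_min lexx orbT.
    move=> b /andP[b0 bs]; have [bls|sb] := ltP b s.
      by apply: below; rewrite b0.
    have [->|nsb] := eqVneq b s; first exact: Ss.
    have h0 : 0 < b - s by rewrite subr_gt0 lt_neqAle eq_sym nsb.
    split.
      apply: UKD; rewrite b0 (le_trans bs) // -lerBrDl.
      by rewrite ge_min lexx orbT.
    have br : b - s <= r by rewrite lerBlDl.
    have /he : ball 0 e (b - s).
      rewrite /ball /= sub0r normrN gtr0_norm // (le_lt_trans br) //.
      by rewrite (@le_lt_trans _ _ (e / 2)) ?ge_min ?lexx //; lra.
    rewrite /= gt_eqF // => /(_ isT).
    rewrite [(b - s) *: 1]mulr1 subrK pmulr_rlt0 ?invr_gt0 // subr_lt0 => fb.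
    by case: Ss => _; apply: le_trans; exact: ltW.
  move=> /(sup_upper_bound hT); rewrite gerDl.
  by rewrite leNgt r0.
move=> /andP[a0]; rewrite -sE le_eqVlt => /orP[/eqP-> //|als].
by apply: below; rewrite a0.
Unshelve. all: by end_near.
Qed.

Lemma descent_step :
  S (K + alpha *: D) /\
  f (K + alpha *: D) - f K <= - (alpha * c / 2) * frob_norm D ^+ 2.
Proof.
split; first by apply: segment_in_sublevel; rewrite alpha0 lexx.
set d := frob_norm D ^+ 2.
(* The subtracted quadratic has the bound of [slope_le] as its derivative, so [g] has nonpositive
   derivative and the mean value theorem gives [g alpha <= g 0]. *)
pose g a := f (K + a *: D) - (L / 2 * a ^+ 2 - c * a) * d.
have dg a : 0 <= a <= alpha ->
  is_derive a 1 g (frob_inner (gradient f (K + a *: D)) D - (L * a - c) * d).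
  move=> /segment_in_sublevel /df /is_derive_line hf.
  pose p : F -> F := d \*: ((L / 2) \*: ((@id F) ^+ 2) - c \*: (@id F)).
  have hp : is_derive a 1 p ((L * a - c) * d).
    by apply: is_derive_eq; rewrite /GRing.scale /= expr1; field.
  have := is_deriveB hf hp; rewrite (_ : _ - p = g) //.
  by apply/funext => b; rewrite /g [_ * d]mulrC.
have gc : {within `[0, alpha], continuous g}.
  apply: derivable_within_continuous => a; rewrite in_itv /= => /dg h.
  exact: ex_derive.
have dgi a : a \in `]0, alpha[ ->
    is_derive a 1 g (frob_inner (gradient f (K + a *: D)) D - (L * a - c) * d).
  by rewrite in_itv /= => /andP[? ?]; apply: dg; rewrite !ltW.
have [a] := MVT_segment alpha0 dgi gc.
rewrite in_itv /= => ha gE.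
have : g alpha - g 0 <= 0.
  rewrite gE subr0 mulr_le0_ge0 // subr_le0 slope_le //.
    by case/andP: ha.
  exact: segment_in_sublevel.
rewrite /g scale0r addr0 expr0n /= !mulr0 subr0 mul0r subr0.
rewrite addrAC subr_le0 => /le_trans; apply.
have d0 : 0 <= d by rewrite sqr_ge0.
rewrite ler_wpM2r //.
(* This turns [L / 2 * alpha ^+ 2 - c * alpha] into at most [- (alpha * c / 2)]. *)
have : L * alpha <= c by rewrite mulrC -ler_pdivlMr.
move=> h; have := ler_wpM2r alpha0 h; rewrite expr2; lra.
Qed.

End Descent.

(** * Linear convergence of the iteration *)

Unset Implicit Arguments.

Theorem theorem5 (F : realType) (n m M : nat) (hM : (1 <= M)%N)
  (A : 'I_M -> 'M[F]_n) (B : 'I_M -> 'M[F]_(n, m))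
  (Q : 'M[F]_n) (R : 'M[F]_m) (hQ : sym_psd Q) (hR : sym_pd R)
  (gamma L mu c_d abar alpha : F) (Kstar : 'M[F]_(m, n))
  (hne : K_js A B !=set0)
  (hcompact : compact (K_js_sub Q R A B gamma))
  (hC1 : continuously_differentiable_on (J_SA Q R A B) (K_js_sub Q R A B gamma))
  (hL : 0 < L)
  (hsmooth : smooth_on L (J_SA Q R A B) (K_js_sub Q R A B gamma))
  (hmu : 0 < mu)
  (hKstar : K_js_sub Q R A B gamma Kstar)
  (hmin : forall K, K_js A B K -> J_SA Q R A B Kstar <= J_SA Q R A B K)
  (hdom : forall K, K_js_sub Q R A B gamma K ->
     J_SA Q R A B K - J_SA Q R A B Kstar
       <= 1 / (2 * mu) * frob_norm (gradient (J_SA Q R A B) K) ^+ 2)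
  (hc_d : 0 < c_d)
  (hdescent : forall K, K_js_sub Q R A B gamma K ->
     frob_inner (gradient (J_SA Q R A B) K) (Delta Q R A B K)
       <= - c_d * frob_norm (Delta Q R A B K) ^+ 2)
  (habar : 0 < abar)
  (halpha : alpha = Num.min abar (c_d / L))
  (hstay : forall K0, K_js_sub Q R A B gamma K0 ->
     forall (i : nat) (a : F), 0 <= a <= abar ->
       K_js A B (policy_iter Q R A B alpha K0 i
                 + a *: Delta Q R A B (policy_iter Q R A B alpha K0 i))) :
  exists q : F, 0 < q < 1 /\
    forall K0, K_js_sub Q R A B gamma K0 ->
      forall i : nat,
        J_SA Q R A B (policy_iter Q R A B alpha K0 i) - J_SA Q R A B Kstar
          <= q ^+ i * (J_SA Q R A B K0 - J_SA Q R A B Kstar).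
Proof.
set J := J_SA Q R A B; set S := K_js_sub Q R A B gamma.
have Sclosed : closed S.
  by apply: compact_closed hcompact; exact: norm_hausdorff.
have [C C0 hC] : exists2 C, 0 < C & forall K, S K ->
    frob_norm (gradient J K) ^+ 2 <= C * frob_norm (Delta Q R A B K) ^+ 2.
  apply: gradient_le_Delta => //; first by move=> K [].
  by case: hC1.
have alpha0 : 0 < alpha by rewrite halpha lt_min habar divr_gt0.
have alpha_le : alpha <= c_d / L by rewrite halpha ge_min lexx orbT.
pose r := alpha * c_d * mu / C.
have r0 : 0 < r by rewrite divr_gt0 // !mulr_gt0.
have gap0 K : S K -> 0 <= J K - J Kstar.
  by move=> [hK _]; rewrite subr_ge0 hmin.
have step K : S K -> S (K + alpha *: Delta Q R A B K) /\
    J (K + alpha *: Delta Q R A B K) - J Kstar <= (1 - r) * (J K - J Kstar).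
  move=> SK; set D := Delta Q R A B K.
  have UKD a : 0 <= a <= alpha -> K_js A B (K + a *: D).
    (* Every [K] in the sublevel set may serve as an initial gain, so the stability hypothesis at
       index 0 covers the segment starting at [K]. *)
    move=> /andP[a0 aa]; apply: (hstay K SK 0%N a); rewrite a0 (le_trans aa) //.
    by rewrite halpha ge_min lexx.
  have [SK' dec] := descent_step Sclosed hL (ltW alpha0) alpha_le hC1.1 hsmooth
    SK (hdescent K SK) UKD.
  split => //.
  have gap : J K - J Kstar <= C / (2 * mu) * frob_norm D ^+ 2.
    apply: le_trans (hdom K SK) _.
    have -> : C / (2 * mu) * frob_norm D ^+ 2 =
        1 / (2 * mu) * (C * frob_norm D ^+ 2) by ring.
    by apply: ler_wpM2l (hC K SK); rewrite divr_ge0 // mulr_ge0 // ltW.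
  (* [r] is chosen so that [r * (C / (2 * mu)) = alpha * c_d / 2]: the guaranteed decrease is at
     least the fraction [r] of the gap. *)
  have : r * (J K - J Kstar) <= alpha * c_d / 2 * frob_norm D ^+ 2.
    apply: le_trans (ler_wpM2l (ltW r0) gap) _; rewrite le_eqVlt; apply/orP; left.
    by apply/eqP; rewrite /r; field; rewrite !gt_eqF.
  by move: dec; rewrite -/J; lra.
(* The maximum with [1 / 2] makes the ratio positive, since [1 - r] might not be; enlarging the
   ratio is harmless because the gap is nonnegative. *)
exists (Num.max (1 / 2) (1 - r)); split.
  rewrite lt_max gt_max; apply/andP.
  by split; [apply/orP; left | apply/andP; split]; lra.
move=> K0 SK0 i.
have q0 : 0 <= Num.max (1 / 2) (1 - r) by rewrite le_max; apply/orP; left; lra.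
(* Membership in the sublevel set is carried through the induction, as the one-step contraction
   needs it at each iterate. *)
suff [] : S (policy_iter Q R A B alpha K0 i) /\
    J (policy_iter Q R A B alpha K0 i) - J Kstar
      <= Num.max (1 / 2) (1 - r) ^+ i * (J K0 - J Kstar) by [].
elim: i => [|i [Si hi]]; first by rewrite expr0 mul1r.
have [Si1 hi1] := step _ Si; split; first exact: Si1.
apply: le_trans hi1 _; rewrite exprS -mulrA.
apply: le_trans (ler_wpM2l q0 hi); rewrite ler_wpM2r ?gap0 //.
by rewrite le_max lexx orbT.
Qed.
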